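(* For each noncomputable c.e. set $A$, there is a co-c.e. set $G\le_{\mathrm T}A$ such that $G\in\mathcal{T}$, i.e., the sequence $(G_n)_{n\in\omega}$ encoded by $G$ is a maximal tower of computable sets.
   Context: For sets $A,B\subseteq\omega$, $A\subseteq^* B$ means $A\setminus B$ is finite. With $\langle\cdot,\cdot\rangle$ the usual computable Cantor pairing function on $\omega$, a set $X\subseteq\omega$ encodes the sequence $(X_n)_{n\in\omega}$ of its columns $X_n=\{u:\langle u,n\rangle\in X\}$. A set $G$ is a tower of computable sets if each $G_n$ is computable, $G_0=\omega$, and for each $n$, $G_{n+1}\subseteq^* G_n$ and $G_n\setminus G_{n+1}$ is infinite. It is maximal if for each infinite computable set $R$ there is $n$ such that $R\setminus G_n$ is infinite. $\mathcal{T}$ is the class of sets $G$ encoding maximal towers of computable sets. A set is co-c.e. if its complement in $\omega$ is computably enumerable. *)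

(* Defs.v *)
From Stdlib Require Cantor.
From mathcomp Require Import all_boot.
From mathcomp Require Import boolp classical_sets functions cardinality.

Set Implicit Arguments.
Unset Strict Implicit.
Unset Printing Implicit Defensive.

Local Open Scope classical_set_scope.

(* <x, y> = (x + y)(x + y + 1)/2 + y *)
Definition cpair (x y : nat) : nat := Cantor.to_nat (x, y).

(* Codes for the partial recursive functions with an oracle. All functions are
   unary; several arguments are passed as one through [cpair]. *)
Inductive code : Type :=
| Zero
| Succ
| Fst
| Snd
| Oracle
| Pair of code & code
| Comp of code & code
| Prec of code & code
| Mu of code.

(* [eval A c x y]: the partial function coded by c, with the characteristic
   function of A as oracle, is defined at x and has value y.
   - h = Prec f g is primitive recursion on the second component:
     h <a, 0> = f a and h <a, m+1> = g <a, <m, h <a, m>>>;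
   - Mu f maps x to the least y with f <x, y> = 0, where f must be defined at
     <x, m> for all m < y. *)
Fixpoint eval (A : set nat) (c : code) (x y : nat) {struct c} : Prop :=
  match c with
  | Zero => y = 0
  | Succ => y = x.+1
  | Fst => y = (Cantor.of_nat x).1
  | Snd => y = (Cantor.of_nat x).2
  | Oracle => y = nat_of_bool `[< A x >]
  | Pair f g => exists u v, [/\ eval A f x u, eval A g x v & y = cpair u v]
  | Comp f g => exists2 z, eval A g x z & eval A f z y
  | Prec f g =>
      let a := (Cantor.of_nat x).1 in
      (fix iter (n r : nat) {struct n} : Prop :=
         match n with
         | 0 => eval A f a r
         | m.+1 => exists2 s, iter m s & eval A g (cpair a (cpair m s)) r
         end) (Cantor.of_nat x).2 y
  | Mu f => eval A f (cpair x y) 0 /\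
            forall m, m < y -> exists r, eval A f (cpair x m) r.+1
  end.

Definition turing_le (B A : set nat) : Prop :=
  exists c, forall x, eval A c x (nat_of_bool `[< B x >]).

(* Oracle-free computability is computability with the empty oracle. *)
Definition computable (B : set nat) : Prop := turing_le B set0.

Definition ce (B : set nat) : Prop :=
  exists c, forall x, B x <-> exists y, eval set0 c x y.

Definition co_ce (B : set nat) : Prop := ce (~` B).

Definition almost_subset (A B : set nat) : Prop := finite_set (A `\` B).

Definition column (X : set nat) (n : nat) : set nat :=
  [set u | X (cpair u n)].

Record computable_tower (G : set nat) : Prop := {
  tower_computable : forall n, computable (column G n);
  tower_start : column G 0 = setT;
  tower_decreasing : forall n, almost_subset (column G n.+1) (column G n);
  tower_strict : forall n, infinite_set (column G n `\` column G n.+1)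
}.

Definition maximal (G : set nat) : Prop :=
  forall R : set nat, computable R -> infinite_set R ->
    exists n, infinite_set (R `\` column G n).

Definition max_towers : set (set nat) :=
  [set G | computable_tower G /\ maximal G].

(* Main.v *)
Require Import Defs.
From Stdlib Require Cantor.
From mathcomp Require Import all_boot.
From mathcomp Require Import boolp classical_sets functions cardinality.

Set Implicit Arguments.
Unset Strict Implicit.
Unset Printing Implicit Defensive.

Local Open Scope classical_set_scope.

(** Regard [psnd u] as the row of [u]. For every program index e let a mark
    move upwards through the numbers, and let S_e be the set of its positions.
    With H_n the union of the rows below n and of S_0, ..., S_(n-1), the n-th
    set of the tower is the complement of H_n.

    A mark enters a strictly higher row at every move. Hence S_e has at most
    one element in each row, so H_n leaves almost all of row n free while
    H_(n+1) swallows it: the tower is strictly decreasing. Since the mark also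
    moves upwards, S_e is the range of a nondecreasing recursive function,
    hence recursive, although not uniformly in e ([range_computable]). So every
    set of the tower is recursive, and the tower as a whole is co-c.e.

    The mark e moves at stage s only to some x that program e has accepted by
    then, and only if A permits x: a number below x is enumerated into A at
    stage s. Permission makes the tower recursive in A: once A has settled
    below u, no mark can newly arrive at u ([mark_permitted]). It costs nothing for
    maximality: suppose that R is infinite and recursive, with index e, and
    almost contained in every set of the tower. Then R meets each row in a
    finite set and S_e, whose positive elements are in R, is finite, so the
    mark e gets stuck. From then on every accepted number x beyond the mark,
    in a higher row, is refused, that is, A no longer changes below x; as
    there are arbitrarily large such x, A is recursive
    ([stuck_mark_computable]).

    The construction treats all programs at once, which needs a universal
    function. It is provided by a stack machine whose configurations are
    numbers and whose step function is recursive; by [run_eval] iterating the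
    step evaluates every program. *)

(** * Total functions recursive in a set *)

Definition pfst (z : nat) : nat := (Cantor.of_nat z).1.
Definition psnd (z : nat) : nat := (Cantor.of_nat z).2.

Lemma pfstK x y : pfst (cpair x y) = x.
Proof. by rewrite /pfst /cpair Cantor.cancel_of_to. Qed.

Lemma psndK x y : psnd (cpair x y) = y.
Proof. by rewrite /psnd /cpair Cantor.cancel_of_to. Qed.

Definition cpairE := (pfstK, psndK).

Lemma cpair_eta z : cpair (pfst z) (psnd z) = z.
Proof.
by rewrite /cpair /pfst /psnd -surjective_pairing Cantor.cancel_to_of.
Qed.

Definition rec_fun (X : set nat) (f : nat -> nat) : Prop :=
  exists c, forall x, eval X c x (f x).

Definition rec_pred (X : set nat) (b : nat -> bool) : Prop :=
  rec_fun X (fun x => nat_of_bool (b x)).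

Lemma eq_rec_fun X f g : f =1 g -> rec_fun X f -> rec_fun X g.
Proof. by move=> fg [c cf]; exists c => x; rewrite -fg. Qed.

Lemma rec_comp X f g :
  rec_fun X f -> rec_fun X g -> rec_fun X (fun x => f (g x)).
Proof. by move=> [c cf] [d dg]; exists (Comp c d) => x; exists (g x). Qed.

Lemma rec_id X : rec_fun X (fun x => x).
Proof.
exists (Pair Fst Snd) => x; exists (pfst x), (psnd x).
by split=> //; rewrite cpair_eta.
Qed.

Lemma rec_succ X f : rec_fun X f -> rec_fun X (fun x => (f x).+1).
Proof. by apply: (@rec_comp X succn); exists Succ. Qed.

Lemma rec_pfst X f : rec_fun X f -> rec_fun X (fun x => pfst (f x)).
Proof. by apply: rec_comp; exists Fst. Qed.

Lemma rec_psnd X f : rec_fun X f -> rec_fun X (fun x => psnd (f x)).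
Proof. by apply: rec_comp; exists Snd. Qed.

Lemma rec_const X n : rec_fun X (fun _ => n).
Proof. by elim: n => [|n IHn]; [exists Zero => x | exact: rec_succ IHn]. Qed.

Lemma rec_cpair X f g :
  rec_fun X f -> rec_fun X g -> rec_fun X (fun x => cpair (f x) (g x)).
Proof.
by move=> [c cf] [d dg]; exists (Pair c d) => x; exists (f x), (g x).
Qed.

Lemma rec_oracle X f : rec_fun X f -> rec_pred X (fun x => `[< X (f x) >]).
Proof. by apply: (@rec_comp X (fun x => `[< X x >] : nat)); exists Oracle. Qed.

Lemma eval_prec0 X f g a y :
  eval X (Prec f g) (cpair a 0) y <-> eval X f a y.
Proof. by rewrite /= /cpair Cantor.cancel_of_to. Qed.

Lemma eval_precS X f g a m y :
  eval X (Prec f g) (cpair a m.+1) y <->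
  exists2 s, eval X (Prec f g) (cpair a m) s
           & eval X g (cpair a (cpair m s)) y.
Proof.
have of_cpair m' : Cantor.of_nat (cpair a m') = (a, m').
  exact: Cantor.cancel_of_to.
move: (of_cpair m) (of_cpair m.+1).
by move: (cpair a m) (cpair a m.+1) => z z' /= -> ->.
Qed.

Lemma rec_prec X (F : nat -> nat -> nat) (G : nat -> nat -> nat -> nat) p n :
  (forall a m, F a m.+1 = G a m (F a m)) ->
  rec_fun X (fun a => F a 0) ->
  rec_fun X (fun z => G (pfst z) (pfst (psnd z)) (psnd (psnd z))) ->
  rec_fun X p -> rec_fun X n ->
  rec_fun X (fun x => F (p x) (n x)).
Proof.
move=> FS [c cF] [d dG] rp rn.
suff rF : rec_fun X (fun z => F (pfst z) (psnd z)).
  apply: eq_rec_fun (rec_comp rF (rec_cpair rp rn)) => x.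
  by rewrite !cpairE.
exists (Prec c d) => z; rewrite -[z in eval _ _ z]cpair_eta.
elim: (psnd z) => [|m IHm]; first by apply/eval_prec0/cF.
apply/eval_precS; exists (F (pfst z) m) => //.
by have := dG (cpair (pfst z) (cpair m (F (pfst z) m))); rewrite !cpairE FS.
Qed.

(** A case distinction is primitive recursion on the truth value 0 or 1. *)
Lemma rec_if X b f g :
  rec_pred X b -> rec_fun X f -> rec_fun X g ->
  rec_fun X (fun x => if b x then f x else g x).
Proof.
move=> rb rf rg.
pose F a n := if n is 0 then g a else f a.
apply: (@eq_rec_fun _ (fun x => F x (b x))) => [x|].
  by rewrite /F; case: (b x).
apply: (@rec_prec _ _ (fun a _ _ => f a)) => //; last exact: rec_id.
by apply: rec_comp => //; apply/rec_pfst/rec_id.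
Qed.

Lemma rec_iter X F n f :
  rec_fun X F -> rec_fun X n -> rec_fun X f ->
  rec_fun X (fun x => iter (n x) F (f x)).
Proof.
move=> rF rn rf.
apply: (@rec_prec _ (fun a n => iter n F a) (fun _ _ s => F s)) => //.
- exact: rec_id.
- by apply: rec_comp => //; do 2!apply: rec_psnd; apply: rec_id.
Qed.

Lemma rec_predn X f : rec_fun X f -> rec_fun X (fun x => (f x).-1).
Proof.
move=> rf; apply: (@rec_prec _ (fun _ n => n.-1) (fun _ m _ => m) id) => //.
- exact: rec_const.
- by apply/rec_pfst/rec_psnd/rec_id.
- exact: rec_id.
Qed.

Lemma rec_sub X f g :
  rec_fun X f -> rec_fun X g -> rec_fun X (fun x => f x - g x).
Proof.
move=> rf rg.
apply: (@rec_prec _ (fun a n => a - n) (fun _ _ s => s.-1)) => //.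
- by move=> a m; rewrite subnS.
- by apply: eq_rec_fun (@rec_id _) => x; rewrite subn0.
- by apply/rec_predn/rec_psnd/rec_psnd/rec_id.
Qed.

Lemma rec_false X : rec_pred X (fun=> false).
Proof. exact: rec_const. Qed.

Lemma rec_true X : rec_pred X (fun=> true).
Proof. exact: rec_const. Qed.

Lemma rec_pred_if X b c d : rec_pred X b -> rec_pred X c -> rec_pred X d ->
  rec_pred X (fun x => if b x then c x else d x).
Proof.
move=> rb rc rd; apply: eq_rec_fun (rec_if rb rc rd) => x.
by case: (b x).
Qed.

Lemma rec_and X b c :
  rec_pred X b -> rec_pred X c -> rec_pred X (fun x => b x && c x).
Proof. by move=> rb rc; apply: rec_pred_if => //; apply: rec_false. Qed.

Lemma rec_or X b c :
  rec_pred X b -> rec_pred X c -> rec_pred X (fun x => b x || c x).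
Proof. by move=> rb rc; apply: rec_pred_if => //; apply: rec_true. Qed.

Lemma rec_not X b : rec_pred X b -> rec_pred X (fun x => ~~ b x).
Proof.
by move=> rb; apply: rec_pred_if => //; [apply: rec_false | apply: rec_true].
Qed.

Lemma rec_leq X f g :
  rec_fun X f -> rec_fun X g -> rec_pred X (fun x => f x <= g x).
Proof.
move=> rf rg.
apply: (@eq_rec_fun _ (fun x => 1 - (f x - g x))) => [x|].
  by rewrite /leq; case: (f x - g x).
by do !apply: rec_sub => //; apply: rec_const.
Qed.

Lemma rec_eq X f g :
  rec_fun X f -> rec_fun X g -> rec_pred X (fun x => f x == g x).
Proof.
move=> rf rg; apply: (@eq_rec_fun _ (fun x => (f x <= g x) && (g x <= f x))).
  by move=> x; rewrite eqn_leq.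
by apply: rec_and; apply: rec_leq.
Qed.

Lemma rec_search X (b : nat -> nat -> bool) f :
  rec_pred X (fun z => b (pfst z) (psnd z)) ->
  (forall x, b x (f x)) -> (forall x m, m < f x -> ~~ b x m) ->
  rec_fun X f.
Proof.
move=> /rec_not [c cb] bf min_f; exists (Mu c) => x; split.
  by have := cb (cpair x (f x)); rewrite !cpairE bf.
move=> m lt_m; exists 0.
by have := cb (cpair x m); rewrite !cpairE min_f.
Qed.

Lemma rec_least X (b : nat -> nat -> bool) :
  rec_pred X (fun z => b (pfst z) (psnd z)) -> (forall x, exists y, b x y) ->
  exists2 f, rec_fun X f & forall x, b x (f x) /\ forall y, b x y -> f x <= y.
Proof.
move=> rb ex_b; pose f x := ex_minn (ex_b x).
have fP x : b x (f x) /\ forall y, b x y -> f x <= y.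
  by rewrite /f; case: ex_minnP.
exists f => //; apply: (rec_search rb) => [x|x m]; first by have [] := fP x.
by have [_ min_f] := fP x; rewrite ltnNge; apply: contra => /min_f.
Qed.

Lemma rec_find X (b : nat -> nat -> bool) n :
  rec_pred X (fun z => b (pfst z) (psnd z)) -> rec_fun X n ->
  rec_fun X (fun x => find (b x) (iota 0 (n x))).
Proof.
move=> rb rn.
(* n x counts as a hit: it is the value of an unsuccessful find *)
apply: (@rec_search _ (fun x k => (n x <= k) || b x k)).
- by apply: rec_or => //; apply: rec_leq;
    [apply: rec_comp => // ; apply/rec_pfst/rec_id | apply/rec_psnd/rec_id].
- move=> x; case: leqP => //= lt_n.
  have hb : has (b x) (iota 0 (n x)) by rewrite has_find size_iota.
  by have := nth_find 0 hb; rewrite nth_iota.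
- move=> x m lt_m.
  have lt_mn : m < n x.
    by apply: leq_trans lt_m _; rewrite -[leqRHS](size_iota 0) find_size.
  rewrite leqNgt lt_mn /=.
  by have := before_find 0 lt_m; rewrite nth_iota // => ->.
Qed.

Lemma rec_has X (b : nat -> nat -> bool) n :
  rec_pred X (fun z => b (pfst z) (psnd z)) -> rec_fun X n ->
  rec_pred X (fun x => has (b x) (iota 0 (n x))).
Proof.
move=> rb rn.
apply: (@eq_rec_fun _ (fun x => (find (b x) (iota 0 (n x)) < n x))).
  by move=> x; rewrite has_find size_iota.
by apply: rec_leq => //; apply/rec_succ/rec_find.
Qed.

Lemma rec_computable X (B : set nat) b :
  rec_pred X b -> (forall x, B x <-> b x) -> turing_le B X.
Proof.
move=> [c cb] Bb; exists c => x; have -> // : `[< B x >] = b x.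
by apply/asboolP/idP => /Bb.
Qed.

(** Determinism of evaluation is what excludes a spurious value of the search
    in [rec_ce] below: the search tests a total function, so any value that
    the program takes there is the right one. *)
Lemma eval_inj X c x y y' : eval X c x y -> eval X c x y' -> y = y'.
Proof.
elim: c x y y' => [||||| f IHf g IHg | f IHf g IHg | f IHf g IHg | f IHf]
  x y y'.
1-5: by move=> /= -> ->.
- by move=> [u [v [fu gv ->]]] [u' [v' [/IHf-/(_ _ fu)-> /IHg-/(_ _ gv)-> ->]]].
- by move=> [u /IHg gu /IHf fu] [v /gu <- /fu].
- rewrite -[x]cpair_eta; elim: (psnd x) y y' => [|m IHm] y y'.
    by move=> /eval_prec0/IHf fy /eval_prec0/fy.
  by move=> /eval_precS[s /IHm hs /IHg gs] /eval_precS[t /hs <- /gs].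
- move=> [fy min_y] [fy' min_y']; case: (ltngtP y y') => //.
    by move=> /min_y'[r /IHf-/(_ _ fy)].
  by move=> /min_y[r /IHf-/(_ _ fy')].
Qed.

Lemma rec_ce (B : set nat) (b : nat -> nat -> bool) :
  rec_pred set0 (fun z => b (pfst z) (psnd z)) ->
  (forall x, B x <-> exists s, b x s) -> ce B.
Proof.
move=> /rec_not [c cb] Bb; exists (Mu c) => x.
have {}cb s : eval set0 c (cpair x s) (~~ b x s).
  by have := cb (cpair x s); rewrite !cpairE.
rewrite Bb; split=> [ex_b | [s [/eval_inj/(_ (cb s)) bs _]]].
  have [s bs min_s] := ex_minnP ex_b; exists s; split.
    by have := cb s; rewrite bs.
  move=> m lt_m; exists 0; have := cb m.
  by case bm: (b x m) => //; have := min_s _ bm; rewrite leqNgt lt_m.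
by exists s; case: (b x s) bs.
Qed.

#[local] Hint Resolve rec_id rec_const : rec.
#[local] Hint Resolve rec_succ rec_predn rec_pfst rec_psnd rec_cpair rec_if
  rec_find rec_has rec_and rec_or rec_not rec_leq rec_eq : rec.

(** * A universal machine *)

(** The successor tells a nonempty stack from the empty stack 0. *)
Definition push (h t : nat) : nat := (cpair h t).+1.

Definition conf (x stack : nat) : nat := cpair x stack.

(** A stack entry is a pair of a tag and a parameter. The tags 0 to 8 are the
    constructors of programs: the entry [encode c] asks to replace the current
    value x by the value of c at x. The tags 9 to 11 are the frames, which hold
    data of pending computations. The oracle is empty, so it answers 0. *)
Fixpoint encode (c : code) : nat :=
  match c with
  | Zero => cpair 0 0
  | Succ => cpair 1 0
  | Fst => cpair 2 0
  | Snd => cpair 3 0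
  | Oracle => cpair 4 0
  | Pair f g => cpair 5 (cpair (encode f) (encode g))
  | Comp f g => cpair 6 (cpair (encode f) (encode g))
  | Prec f g => cpair 7 (cpair (encode f) (encode g))
  | Mu f => cpair 8 (encode f)
  end.

(** After f has been evaluated at x for the sake of [Pair f g]: set the value
    of f aside in a [cons_frame] and evaluate g at x. *)
Definition swap_frame (g x : nat) : nat := cpair 9 (cpair g x).
(** Pairs u with the current value. *)
Definition cons_frame (u : nat) : nat := cpair 10 u.
(** Inspects the value of f at [xy], a pair of an argument x and a candidate y
    for the least zero, and either answers y or tries y + 1. *)
Definition mu_frame (f xy : nat) : nat := cpair 11 (cpair f xy).

Definition exec (tag p x k : nat) : nat :=
  if tag == 0 then conf 0 k
  else if tag == 1 then conf x.+1 k
  else if tag == 2 then conf (pfst x) k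
  else if tag == 3 then conf (psnd x) k
  else if tag == 4 then conf 0 k
  else if tag == 5 then
    conf x (push (pfst p) (push (swap_frame (psnd p) x) k))
  else if tag == 6 then conf x (push (psnd p) (push (pfst p) k))
  else if tag == 7 then
    if psnd x == 0 then conf (pfst x) (push (pfst p) k)
    else conf (cpair (pfst x) (psnd x).-1)
      (push (cpair 7 p) (push (cons_frame (psnd x).-1)
        (push (cons_frame (pfst x)) (push (psnd p) k))))
  else if tag == 8 then
    conf (cpair x 0) (push p (push (mu_frame p (cpair x 0)) k))
  else if tag == 9 then
    conf (psnd p) (push (pfst p) (push (cons_frame x) k))
  else if tag == 10 then conf (cpair p x) k
  else if x == 0 then conf (psnd (psnd p)) k
  else let xy := cpair (pfst (psnd p)) (psnd (psnd p)).+1 in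
    conf xy (push (pfst p) (push (mu_frame (pfst p) xy) k)).

Definition step (z : nat) : nat :=
  if psnd z == 0 then z
  else exec (pfst (pfst (psnd z).-1)) (psnd (pfst (psnd z).-1))
            (pfst z) (psnd (psnd z).-1).

Lemma rec_step X f : rec_fun X f -> rec_fun X (fun x => step (f x)).
Proof.
apply: rec_comp.
by rewrite /step /exec /conf /push /swap_frame /cons_frame /mu_frame;
  auto 100 with rec nocore.
Qed.

Lemma step_push tag p x k :
  step (conf x (push (cpair tag p) k)) = exec tag p x k.
Proof. by rewrite /step /conf /push !cpairE. Qed.

Lemma iter_halted y n : iter n step (conf y 0) = conf y 0.
Proof. by elim: n => //= n ->; rewrite /step /conf !cpairE. Qed.

Definition reach (s t : nat) : Prop := exists n, iter n step s = t.

Lemma reach_refl s : reach s s.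
Proof. by exists 0. Qed.

Lemma reach_trans s t u : reach s t -> reach t u -> reach s u.
Proof. by move=> [m <-] [n <-]; exists (n + m); rewrite iterD. Qed.

Lemma reach_step s t : reach (step s) t -> reach s t.
Proof. by move=> [n <-]; exists n.+1; rewrite iterSr. Qed.

(** The arbitrary rest k of the stack is what lets the induction hypotheses be
    chained: subprograms run on top of the frames of the calling program. *)
Lemma eval_reach c x y k :
  eval set0 c x y -> reach (conf x (push (encode c) k)) (conf y k).
Proof.
elim: c x y k => [||||| f IHf g IHg | f IHf g IHg | f IHf g IHg | f IHf] x y k;
  last first.
- move=> [fy min_y]; apply: reach_step; rewrite step_push /exec /=.
  have loop m : m <= y -> reach (conf (cpair x 0)
        (push (encode f) (push (mu_frame (encode f) (cpair x 0)) k)))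
      (conf (cpair x m)
        (push (encode f) (push (mu_frame (encode f) (cpair x m)) k))).
    elim: m => [_|m IHm lt_m]; first exact: reach_refl.
    apply: reach_trans (IHm (ltnW lt_m)) _.
    have [r fr] := min_y m lt_m.
    apply: reach_trans (IHf _ _ _ fr) _; apply: reach_step.
    by rewrite step_push /exec /= !cpairE; apply: reach_refl.
  apply: reach_trans (loop y (leqnn y)) _.
  apply: reach_trans (IHf _ _ _ fy) _; apply: reach_step.
  by rewrite step_push /exec /= !cpairE; apply: reach_refl.
- rewrite -[x]cpair_eta; elim: (psnd x) y k => [|m IHm] y k.
    move=> /eval_prec0/IHf fy; apply: reach_step.
    by rewrite step_push /exec /= !cpairE; apply: fy.
  move=> /eval_precS[s /IHm hs gs]; apply: reach_step.
  rewrite step_push /exec /= !cpairE; apply: reach_trans (hs _) _.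
  do 2!(apply: reach_step; rewrite step_push /exec /=).
  exact: IHg.
- move=> [z gz fz]; apply: reach_step; rewrite step_push /exec /= !cpairE.
  by apply: reach_trans (IHg _ _ _ gz) _; apply: IHf.
- move=> [u [v [fu gv ->]]]; apply: reach_step.
  rewrite step_push /exec /= !cpairE; apply: reach_trans (IHf _ _ _ fu) _.
  apply: reach_step; rewrite step_push /exec /= !cpairE.
  apply: reach_trans (IHg _ _ _ gv) _; apply: reach_step.
  by rewrite step_push /exec /=; apply: reach_refl.
all: move=> /= ->; apply: reach_step; rewrite step_push /exec /=.
1: by rewrite asboolF //; apply: reach_refl.
all: exact: reach_refl.
Qed.

Definition halts_in (n s y : nat) : Prop := iter n step s = conf y 0.

Lemma halts_push n tag p x k y :
  halts_in n (conf x (push (cpair tag p) k)) y ->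
  exists2 m, n = m.+1 & halts_in m (exec tag p x k) y.
Proof.
case: n => [/(congr1 psnd)|n]; first by rewrite /conf !cpairE.
by rewrite /halts_in iterSr step_push; exists n.
Qed.

(** The induction is on the length of the run and not on the program: primitive
    recursion puts the same program on the stack again, and a search returns to
    the same subprogram an unknown number of times. *)
Lemma halts_eval n c x k y :
  halts_in n (conf x (push (encode c) k)) y ->
  exists z m, [/\ m < n, eval set0 c x z & halts_in m (conf z k) y].
Proof.
elim/ltn_ind: n c x k => n IHn c x k.
case: c => [||||| f g | f g | f g | f] /= /halts_push[m En]; subst n;
  rewrite /exec /= ?cpairE.
1-4: by move=> hm; do 2!eexists; split; [|reflexivity|exact: hm].
- by move=> hm; exists 0, m; split=> //; rewrite asboolF.
- move=> /IHn-/(_ (ltnSn m))[u [n1 [lt1 fu /halts_push[n2 En1]]]].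
  subst n1; rewrite /exec /= ?cpairE.
  have lt2 : n2 < m.+1 by do 2!apply: ltnW.
  move=> /IHn-/(_ lt2)[v [n3 [lt3 gv /halts_push[n4 En3]]]].
  subst n3; rewrite /exec /= => hn4; exists (cpair u v), n4; split=> //.
    by apply: ltn_trans lt2; apply: ltnW.
  by exists u, v.
- move=> /IHn-/(_ (ltnSn m))[u [n1 [lt1 gu]]].
  have lt2 : n1 < m.+1 by apply: ltnW.
  move=> /IHn-/(_ lt2)[v [n3 [lt3 fv hn3]]].
  by exists v, n3; split=> //; [apply: ltn_trans lt2 | exists u].
- case: eqP => [x2 /IHn-/(_ (ltnSn m))[y1 [n1 [lt1 fy hn1]]]|/eqP].
    exists y1, n1; split=> //; first exact: ltnW.
    by rewrite -[x]cpair_eta x2; apply/eval_prec0.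
  rewrite -lt0n => /prednK; set a := pfst x; set j := (psnd x).-1 => x2.
  move=> /(IHn _ (ltnSn m) (Prec f g))[s [n1 [lt1 hs /halts_push[n2 En1]]]].
  subst n1; rewrite /exec /= => /halts_push[n3 En2].
  subst n2; rewrite /exec /=.
  have lt3 : n3 < m.+1 by do 3!apply: ltnW.
  move=> /IHn-/(_ lt3)[v [n4 [lt4 gv hn4]]].
  exists v, n4; split=> //; first by apply: ltn_trans lt3.
  by rewrite -[x]cpair_eta -x2; apply/eval_precS; exists s.
- move=> hm.
  (* a terminating search started at candidate i finds a least zero z >= i *)
  have loop i n1 : n1 <= m -> halts_in n1 (conf (cpair x i)
      (push (encode f) (push (mu_frame (encode f) (cpair x i)) k))) y ->
    exists z n2, [/\ n2 < n1, i <= z, eval set0 f (cpair x z) 0,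
      forall j, i <= j < z -> exists r, eval set0 f (cpair x j) r.+1
      & halts_in n2 (conf z k) y].
    elim/ltn_ind: n1 i => n1 IHn1 i le1.
    move=> /IHn-/(_ le1)[u [n2 [lt2 fu /halts_push[n3 En2]]]].
    subst n2; rewrite /exec /= ?cpairE.
    have lt3 : n3 < n1 by apply: ltnW.
    case: u fu => [|u] fu /=.
      by exists i, n3; split=> // j /andP[/leq_ltn_trans/[apply]]; rewrite ltnn.
    move=> /IHn1-/(_ lt3 (leq_trans (ltnW lt3) le1)).
    move=> [z [n4 [lt4 le_z fz min_z hn4]]].
    exists z, n4; split=> //; first exact: ltn_trans lt3.
      exact: ltnW.
    move=> j /andP[]; rewrite leq_eqVlt => /predU1P[<- _|lt_ij lt_j].
      by exists u.
    by apply: min_z; rewrite lt_ij.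
  have [z [n2 [lt2 _ fz min_z hn2]]] := loop _ _ (leqnn m) hm.
  by exists z, n2; split=> //; apply: ltnW.
Qed.

Definition run (e x s : nat) : nat := iter s step (conf x (push e 0)).

Lemma rec_run X e x s : rec_fun X e -> rec_fun X x -> rec_fun X s ->
  rec_fun X (fun z => run (e z) (x z) (s z)).
Proof.
move=> re rx rs; apply: rec_iter => //; first exact/rec_step/rec_id.
by rewrite /conf /push; auto with rec nocore.
Qed.

#[local] Hint Resolve rec_run : rec.

Lemma run_halted_le e x s t y :
  s <= t -> run e x s = conf y 0 -> run e x t = conf y 0.
Proof.
by rewrite /run => /subnK <- Es; rewrite iterD Es iter_halted.
Qed.

Lemma run_eval c x y :
  eval set0 c x y <-> exists s, run (encode c) x s = conf y 0.
Proof.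
split=> [/(eval_reach 0) // | [s /halts_eval[z [m [_ cz]]]]].
by rewrite /halts_in iter_halted => /(congr1 pfst); rewrite /conf !cpairE => <-.
Qed.

(** * Marks moved with permission *)

Definition accepts (e s x : nat) : bool := run e x s == conf 1 0.
Definition halts (e s x : nat) : bool := psnd (run e x s) == 0.

Lemma rec_accepts X e s x : rec_fun X e -> rec_fun X s -> rec_fun X x ->
  rec_pred X (fun z => accepts (e z) (s z) (x z)).
Proof. by rewrite /accepts; auto with rec nocore. Qed.

Lemma rec_halts X e s x : rec_fun X e -> rec_fun X s -> rec_fun X x ->
  rec_pred X (fun z => halts (e z) (s z) (x z)).
Proof. by rewrite /halts; auto with rec nocore. Qed.

#[local] Hint Resolve rec_accepts rec_halts : rec.

Lemma haltsP e s x : halts e s x -> run e x s = conf (pfst (run e x s)) 0.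
Proof. by move=> /eqP hs; rewrite -[LHS]cpair_eta hs. Qed.

Lemma halts_le e s t x : s <= t -> halts e s x -> halts e t x.
Proof.
move=> le_st /haltsP/(run_halted_le le_st); rewrite /halts => ->.
by rewrite /conf cpairE.
Qed.

Lemma accepts_le e s t x : s <= t -> accepts e s x -> accepts e t x.
Proof. by move=> le_st /eqP/(run_halted_le le_st)/eqP. Qed.

Lemma ce_halts B : ce B -> exists e, forall x, B x <-> exists s, halts e s x.
Proof.
move=> [c cB]; exists (encode c) => x; rewrite cB; split.
  move=> [y /run_eval[s hs]]; exists s.
  by rewrite /halts hs /conf cpairE.
by move=> [s /haltsP hs]; eexists; apply/run_eval; exists s; apply: hs.
Qed.

Lemma computable_accepts R :
  computable R -> exists e, forall x, R x <-> exists s, accepts e s x.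
Proof.
move=> [c cR]; exists (encode c) => x; split=> [Rx|[s /eqP hs]].
  have /run_eval[s hs] := cR x; exists s.
  by rewrite /accepts hs asboolT.
have /(eval_inj (cR x)) : eval set0 c x 1 by apply/run_eval; exists s.
by case: asboolP.
Qed.

Definition permits (a x s : nat) : bool :=
  has (fun y => halts a s.+1 y && ~~ halts a s y) (iota 0 x).

Definition eligible (a e s m x : nat) : bool :=
  [&& m < x, psnd m < psnd x, accepts e s x & permits a x s].

(** Only the present position of the mark is recorded: being nondecreasing, it
    determines the positions that are still possible, which is what makes the
    range recursive. The bound t on the new position keeps the search for an
    eligible one primitive recursive. *)
Fixpoint mark (a e s : nat) : nat :=
  match s with
  | 0 => 0
  | t.+1 => let x := find (eligible a e t (mark a e t)) (iota 0 t) in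
            if x < t then x else mark a e t
  end.

Lemma rec_mark X a e s : rec_fun X e -> rec_fun X s ->
  rec_fun X (fun z => mark a (e z) (s z)).
Proof.
move=> re rs.
apply: (@rec_prec _ (mark a) (fun e t m =>
  let x := find (eligible a e t m) (iota 0 t) in if x < t then x else m)) => //.
  exact: rec_const.
by rewrite /eligible /permits; auto 100 with rec nocore.
Qed.

#[local] Hint Resolve rec_mark : rec.

Lemma markS a e s : mark a e s.+1 = mark a e s \/
  eligible a e s (mark a e s) (mark a e s.+1).
Proof.
rewrite /=; case: ifP => lt_s; [right | by left].
set b := eligible _ _ _ _ in lt_s *.
have hb : has b (iota 0 s) by rewrite has_find size_iota.
by have := nth_find 0 hb; rewrite nth_iota.
Qed.

Lemma mark_moves a e s x : x < s -> eligible a e s (mark a e s) x ->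
  mark a e s < mark a e s.+1.
Proof.
move=> lt_xs el; have [|/andP[] //] := markS a e s.
rewrite /=; set b := eligible _ _ _ _ in el *.
have hb : has b (iota 0 s) by apply/hasP; exists x; rewrite // mem_iota.
have lt_f : find b (iota 0 s) < s by rewrite -[ltnRHS](size_iota 0) -has_find.
rewrite lt_f => Ef; have := nth_find 0 hb; rewrite nth_iota // add0n Ef.
by rewrite /b /eligible ltnn.
Qed.

Lemma mark_le a e s t : s <= t -> mark a e s = mark a e t \/
  mark a e s < mark a e t /\ psnd (mark a e s) < psnd (mark a e t).
Proof.
elim: t => [|t IHt]; first by rewrite leqn0 => /eqP->; left.
rewrite leq_eqVlt => /predU1P[->|]; first by left.
rewrite ltnS => /IHt{IHt} IH.
have [-> //|/and4P[lt1 lt2 _ _]] := markS a e t.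
right; case: IH => [-> //|[lt3 lt4]].
by split; [apply: ltn_trans lt1 | apply: ltn_trans lt2].
Qed.

Lemma leq_mark a e s t : s <= t -> mark a e s <= mark a e t.
Proof. by move=> /(mark_le a e)[-> //|[/ltnW]]. Qed.

Lemma mark_row_inj a e s t :
  psnd (mark a e s) = psnd (mark a e t) -> mark a e s = mark a e t.
Proof.
case: (leqP s t) => [|/ltnW] /(mark_le a e)[-> //|[_ lt_st]] Est.
  by rewrite Est ltnn in lt_st.
by rewrite Est ltnn in lt_st.
Qed.

Lemma mark_accepted a e s :
  mark a e s = 0 \/ exists t, accepts e t (mark a e s).
Proof.
elim: s => [|s IHs]; first by left.
have [-> //|/and4P[_ _ acc _]] := markS a e s.
by right; exists s.
Qed.

(** If the enumeration by a has settled below u at stage s, then the mark does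
    not arrive at u after stage s. *)
Lemma mark_permitted a e u s t :
  (forall y r, y < u -> halts a r y -> halts a s y) ->
  s <= t -> mark a e t = u -> mark a e s = u.
Proof.
move=> settled; elim: t => [|t IHt]; first by rewrite leqn0 => /eqP->.
rewrite leq_eqVlt => /predU1P[-> //|]; rewrite ltnS => le_st Eu.
have [Et|] := markS a e t; first by apply: IHt => //; rewrite -Et.
rewrite Eu => /and4P[_ _ _ /hasP[y]]; rewrite mem_iota /= add0n => lt_y.
by move=> /andP[/(settled _ _ lt_y)/(halts_le le_st)->].
Qed.

(** If the function is unbounded, wait until it reaches x or more: x is in the
    range iff it is the value found. If it is bounded with maximum M, the same
    works for x up to M, and larger x can be rejected at once. *)
Lemma range_computable (m : nat -> nat) :
  rec_fun set0 m -> {homo m : s t / s <= t} -> computable (range m).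
Proof.
move=> rm mono.
have rm_psnd : rec_fun set0 (fun z => m (psnd z)).
  by apply: rec_comp => //; apply/rec_psnd/rec_id.
(* b x s: the value at s tells whether x is in the range *)
have [b [rb ex_b b_leq b_range]] : exists b : nat -> nat -> bool,
    [/\ rec_pred set0 (fun z => b (pfst z) (psnd z)),
        forall x, exists s, b x s, forall x s, x <= m s -> b x s &
        forall s t, b (m t) s -> m t <= m s].
  have [[s0 max_s0]|unbounded] := pselect (exists s0, forall s, m s <= m s0).
    exists (fun x s => (x <= m s) || (m s0 < x)); split=> [|x|x s ->//|s t].
    - by auto 10 with rec nocore.
    - by exists s0; case: leqP.
    - by rewrite ltnNge max_s0 orbF.
  exists (fun x s => x <= m s); split=> //; first by auto 10 with rec nocore.
  elim=> [|x [s le_x]]; first by exists 0.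
  apply: contrapT => no_s; apply: unbounded; exists s => t.
  apply: leq_trans le_x; rewrite leqNgt; apply/negP => lt_x.
  by apply: no_s; exists t.
have [f rf fP] := rec_least rb ex_b.
apply: (@rec_computable _ _ (fun x => m (f x) == x)) => [|x].
  by apply: rec_eq; [apply: rec_comp | apply: rec_id].
split=> [[t _ <-]|/eqP <-]; last by exists (f x).
have [bf min_f] := fP (m t).
by rewrite eqn_leq (b_range _ _ bf) andbT; apply/mono/min_f/b_leq.
Qed.

Lemma finite_set_ub (B : set nat) :
  finite_set B -> exists N, forall x, B x -> x <= N.
Proof.
move=> /finite_seqP[s ->]; exists (\max_(i <- s) i) => x /= xs.
exact: leq_bigmax_seq.
Qed.

Lemma turing_le_setU X B C :
  turing_le B X -> turing_le C X -> turing_le (B `|` C) X.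
Proof.
move=> rB rC; apply: (rec_computable (rec_or rB rC)) => x.
by split=> [[]|/orP[]] /asboolP => [->|->|?|?] //; [rewrite orbT|left|right].
Qed.

(** * The tower *)

Definition caught (a n : nat) : set nat :=
  [set u | exists2 e, e < n & range (mark a e) u].

Definition tower (a : nat) : set nat :=
  [set z | psnd z <= psnd (pfst z) /\ ~ caught a (psnd z) (pfst z)].

Lemma column_tower a n u :
  column (tower a) n u <-> n <= psnd u /\ ~ caught a n u.
Proof. by rewrite /column /tower /= !cpairE. Qed.

Lemma caughtS a n : caught a n.+1 = caught a n `|` range (mark a n).
Proof.
apply/seteqP; split=> u /=.
  move=> [e]; rewrite ltnS leq_eqVlt => /predU1P[->|lt_e ue]; first by right.
  by left; exists e.
by move=> [[e lt_e ue]|un]; [exists e => //; apply: ltnW | exists n].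
Qed.

Lemma computable_caught a n : computable (caught a n).
Proof.
elim: n => [|n IHn].
  by apply: (rec_computable (@rec_false _)) => u; split=> // -[].
rewrite caughtS; apply: turing_le_setU IHn _; apply: range_computable.
  exact: rec_mark (rec_const _ _) (rec_id _).
exact: leq_mark.
Qed.

Lemma computable_column a n : computable (column (tower a) n).
Proof.
apply: (@rec_computable _ _ (fun u => (n <= psnd u) && ~~ `[< caught a n u >])).
  apply: rec_and; first by auto with rec nocore.
  exact: rec_not (computable_caught a n).
move=> u; rewrite column_tower.
by split=> [[-> /asboolF->]|/andP[-> /asboolPn]].
Qed.

(** Each mark leaves a row with its next move, never to return. *)
Lemma finite_caught_row a n j :
  finite_set (caught a n `&` [set u | psnd u = j]).
Proof.
elim: n => [|n IHn]; first by apply: sub_finite_set (finite_set0 _) => u [[]].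
rewrite caughtS setIUl finite_setU; split=> //.
have [[s Es]|no_s] := pselect (exists s, psnd (mark a n s) = j).
  apply: sub_finite_set (finite_set1 (mark a n s)) => u [[t _ <-] /= Et].
  by apply: mark_row_inj; rewrite Es.
apply: sub_finite_set (finite_set0 _) => u [[t _ <-] /= Et].
by apply: no_s; exists t.
Qed.

Lemma infinite_row j : infinite_set [set u | psnd u = j].
Proof.
move=> fin_j; apply: infinite_nat.
apply: sub_finite_set (finite_image pfst fin_j) => x _.
by exists (cpair x j) => /=; rewrite !cpairE.
Qed.

Lemma tower_column_strict a n :
  infinite_set (column (tower a) n `\` column (tower a) n.+1).
Proof.
move=> fin_n; apply: (@infinite_row n).
have fin_caught := finite_caught_row a n n.
have : finite_set ((column (tower a) n `\` column (tower a) n.+1) `|`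
  (caught a n `&` [set u | psnd u = n])) by rewrite finite_setU.
apply: sub_finite_set => u /= En.
have [un|un] := pselect (caught a n u); first by right.
left; split; first by apply/column_tower; rewrite En.
by move=> /column_tower[]; rewrite En ltnn.
Qed.

Lemma computable_tower_tower a : computable_tower (tower a).
Proof.
split.
- exact: computable_column.
- apply/seteqP; split=> // u _; apply/column_tower.
  by split=> // -[].
- move=> n; apply: sub_finite_set (finite_set0 _) => u [].
  move=> /column_tower[lt_n un]; case; apply/column_tower.
  by split; [apply: ltnW | rewrite caughtS in un *; move=> ?; apply: un; left].
- exact: tower_column_strict.
Qed.

Lemma co_ce_tower a : co_ce (tower a).
Proof.
apply: (@rec_ce _ (fun z s => (psnd (pfst z) < psnd z) ||
  has (fun e => mark a e s == pfst z) (iota 0 (psnd z)))).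
  by auto 100 with rec nocore.
move=> z; rewrite /tower /setC /=; split.
  move=> /not_andP[/negP|/contrapT[e lt_e [s _ Es]]].
    by rewrite -ltnNge => ->; exists 0.
  exists s; apply/orP; right; apply/hasP.
  by exists e; rewrite ?mem_iota // Es.
move=> [s /orP[lt_z [le_z _]|/hasP[e]]]; first by rewrite ltnNge le_z in lt_z.
rewrite mem_iota /= add0n => lt_e /eqP Es [_]; apply.
by exists e => //; exists s.
Qed.

Definition enumerates (a : nat) (A : set nat) : Prop :=
  forall x, A x <-> exists s, halts a s x.

Lemma settled_ex a A u : enumerates a A ->
  exists s, forall y, y < u -> A y -> halts a s y.
Proof.
move=> aA; elim: u => [|u [s settled]]; first by exists 0.
have [/aA[t ht]|nAu] := pselect (A u).
  exists (maxn s t) => y; rewrite ltnS leq_eqVlt => /predU1P[-> _|lt_y Ay].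
    exact: halts_le (leq_maxr _ _) ht.
  exact: halts_le (leq_maxl _ _) (settled _ lt_y Ay).
exists s => y; rewrite ltnS leq_eqVlt => /predU1P[->|] //.
exact: settled.
Qed.

(** The oracle A finds a stage at which the enumeration has settled below u. By
    [mark_permitted], the positions of the marks up to that stage decide whether
    u is ever visited. *)
Lemma tower_turing_le a A : enumerates a A -> turing_le (tower a) A.
Proof.
move=> aA; pose unsettled s y := `[< A y >] && ~~ halts a s y.
have [||stage r_stage stageP] := @rec_least A
    (fun u s => ~~ has (unsettled s) (iota 0 u)).
- apply/rec_not/rec_has/rec_pfst/rec_id; rewrite /unsettled.
  apply: rec_and; first exact: rec_oracle (rec_psnd (rec_id _)).
  by auto 100 with rec nocore.
- move=> u; have [s settled] := settled_ex u aA; exists s.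
  apply/hasPn => y; rewrite mem_iota add0n /= => lt_y.
  by rewrite /unsettled; case: asboolP => // /(settled _ lt_y)->.
have settled u y r : y < u -> halts a r y -> halts a (stage u) y.
  move=> lt_y hr; have [/hasPn/(_ y)] := stageP u.
  rewrite mem_iota add0n lt_y /unsettled asboolT /= ?negbK; last first.
    by apply/aA; exists r.
  by move=> h _; apply: h.
pose reached z e :=
  has (fun t => mark a e t == pfst z) (iota 0 (stage (pfst z)).+1).
apply: (@rec_computable _ _ (fun z => (psnd z <= psnd (pfst z)) &&
  ~~ has (reached z) (iota 0 (psnd z)))).
  have := rec_comp r_stage (rec_pfst (rec_pfst (rec_id A))).
  by rewrite /reached; auto 100 with rec nocore.
move=> z; rewrite /tower /=; split.
  move=> [-> z_free] /=; apply/hasPn => e; rewrite mem_iota add0n /= => lt_e.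
  apply/hasPn => t _; apply/eqP => Ez.
  by apply: z_free; exists e => //; exists t.
move=> /andP[-> /hasPn z_free]; split=> // -[e lt_e [t _ Et]].
have /z_free/negP[] : e \in iota 0 (psnd z) by rewrite mem_iota.
apply/hasP.
have [le_t|lt_t] := leqP (stage (pfst z)) t; last first.
  by exists t; rewrite ?mem_iota ?Et //= ltnS ltnW.
exists (stage (pfst z)); first by rewrite mem_iota /= add0n.
by apply/eqP; apply: mark_permitted le_t Et => y r; apply: settled.
Qed.

Lemma halts_entry a s t y : ~~ halts a s y -> halts a t y ->
  exists r, [/\ s <= r, halts a r.+1 y & ~~ halts a r y].
Proof.
move=> nhs; elim: t => [h0|t IHt].
  by case/negP: nhs; apply: halts_le h0.
case ht: (halts a t y) => ht1; first exact: IHt.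
exists t; split; rewrite ?ht // leqNgt.
by apply: contra nhs => /halts_le; apply.
Qed.

(** To decide y, find x > y in R beyond the final position M of the mark, in a
    higher row than M, and a stage s > x by which x is accepted and the mark is
    at M. If y entered A after stage s it would permit x, and the mark would
    move. So y is in A iff it has been enumerated by stage s. *)
Lemma stuck_mark_computable a A e R : enumerates a A ->
  (forall x, R x <-> exists s, accepts e s x) ->
  (forall N, exists x, [/\ R x, N < x & N < psnd x]) ->
  (exists N, forall s, mark a e s <= N) -> computable A.
Proof.
move=> aA eR R_large [N ub].
have [s0 max_s0] : exists s0, forall s, mark a e s <= mark a e s0.
  have ex_v : exists v, `[< exists s, mark a e s = v >].
    by exists 0; apply/asboolP; exists 0.
  have ub_v v : `[< exists s, mark a e s = v >] -> v <= N.
    by move=> /asboolP[s <-].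
  have [v /asboolP[s0 Es0] max_v] := ex_maxnP ex_v ub_v.
  by exists s0 => s; rewrite Es0; apply: max_v; apply/asboolP; exists s.
pose M := mark a e s0.
have stuck t : s0 <= t -> mark a e t = M.
  by move=> le_t; apply/eqP; rewrite eqn_leq max_s0 leq_mark.
(* z is the pair of x and s *)
pose b y z := [&& y < pfst z, M < pfst z, psnd M < psnd (pfst z),
  pfst z < psnd z, s0 <= psnd z & accepts e (psnd z) (pfst z)].
have [||f rf fP] := @rec_least set0 b.
- by rewrite /b; auto 100 with rec nocore.
- move=> y; have [x [/eR[s acc]]] := R_large (maxn y (maxn M (psnd M))).
  rewrite !gtn_max => /and3P[lt_y lt_M _] /and3P[_ _ lt_row].
  exists (cpair x (maxn s (maxn x.+1 s0))).
  rewrite /b !cpairE lt_y lt_M lt_row !leq_max !leqnn !orbT /=.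
  by apply: accepts_le acc; apply: leq_maxl.
apply: (@rec_computable _ _ (fun y => halts a (psnd (f y)) y)).
  by have := rec_psnd rf; auto 10 with rec nocore.
move=> y; split=> [|hy]; last by apply/aA; exists (psnd (f y)).
move=> /aA[t hty]; apply/negPn/negP => nhy.
have [r [le_r hr nhr]] := halts_entry nhy hty.
have [/and5P[lt_y lt_M lt_row lt_s /andP[le_s0 acc]] _] := fP y.
have := @mark_moves a e r (pfst (f y)) (leq_trans lt_s le_r).
rewrite stuck ?(leq_trans le_s0) // ltnNge max_s0 => move_r.
suff /move_r : eligible a e r M (pfst (f y)) by [].
rewrite /eligible lt_M lt_row (accepts_le le_r acc) /=.
by apply/hasP; exists y; rewrite ?mem_iota // hr nhr.
Qed.

(** An infinite R almost contained in every set of the tower keeps out of low rows from some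
    point on, and its part in the range of its own mark is bounded; every
    position of that mark other than the initial 0 lies in R. *)
Lemma maximal_tower a A : enumerates a A -> ~ computable A ->
  maximal (tower a).
Proof.
move=> aA nA R /computable_accepts[e eR] infR; apply: contrapT => no_n.
have fin_n n : finite_set (R `\` column (tower a) n).
  by apply: contrapT => inf_n; apply: no_n; exists n.
apply: nA; apply: (stuck_mark_computable aA eR).
  move=> N; apply: contrapT => no_x; apply: infR.
  have : finite_set (`I_N.+1 `|` (R `\` column (tower a) N.+1)).
    by rewrite finite_setU; split => //; apply: finite_II.
  apply: sub_finite_set => x Rx.
  have [le_x|lt_x] := leqP x N; [by left | right; split=> //].
  by move=> /column_tower[lt_N _]; apply: no_x; exists x.
have [N ub] := finite_set_ub (fin_n e.+1).
exists N => s; have [-> //|[t acc]] := mark_accepted a e s.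
apply: ub; split; first by apply/eR; exists t.
by move=> /column_tower[_]; apply; exists e => //; exists s.
Qed.

Theorem corollary5p3 (A : set nat) (A_ce : ce A) (A_noncomp : ~ computable A) :
  exists G : set nat, [/\ co_ce G, turing_le G A & max_towers G].
Proof.
have [a aA] := ce_halts A_ce; exists (tower a); split.
- exact: co_ce_tower.
- exact: tower_turing_le aA.
- by split; [apply: computable_tower_tower | apply: maximal_tower aA A_noncomp].
Qed.
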